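(* Let $\mathcal V$ be a congruence modular variety, $\mathbb A\in\mathcal V$, $\theta_0,\theta_1,\theta_2\in\operatorname{Con}(\mathbb A)$, and $x,y\in A$. The following are equivalent: (1) $\langle x,y\rangle\in[\theta_0,\theta_1,\theta_2]$; (2) $\left\langle \begin{bmatrix} x & x \\ x & x \end{bmatrix},\begin{bmatrix} x & y \\ x & x \end{bmatrix}\right\rangle\in\Delta_{\theta_0,\theta_1,\theta_2}$; (3) $\left\langle \begin{bmatrix} a_0 & a_1 \\ a_0 & a_1 \end{bmatrix},\begin{bmatrix} a_2 & y \\ a_2 & x \end{bmatrix}\right\rangle\in\Delta_{\theta_0,\theta_1,\theta_2}$ for some $a_0,a_1,a_2\in A$; (4) $\left\langle \begin{bmatrix} b_1 & b_1 \\ b_0 & b_0 \end{bmatrix},\begin{bmatrix} b_2 & b_2 \\ y & x \end{bmatrix}\right\rangle\in\Delta_{\theta_0,\theta_1,\theta_2}$ for some $b_0,b_1,b_2\in A$; (5) $\left\langle \begin{bmatrix} c_1 & y \\ c_0 & c_2 \end{bmatrix},\begin{bmatrix} c_1 & x \\ c_0 & c_2 \end{bmatrix}\right\rangle\in\Delta_{\theta_0,\theta_1,\theta_2}$ for some $c_0,c_1,c_2\in A$.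
   Context: Throughout $2=\{0,1\}$, $3=\{0,1,2\}$; $\mathbb A$ is an algebra with universe $A$. Ternary commutator. For $i\in 3$ and $a,b\in A$, $\operatorname{cube}_i^3(a,b)\in A^{2^3}$ has value $a$ at $f\in 2^3$ with $f_i=0$ and $b$ at $f$ with $f_i=1$. $M(\theta_0,\theta_1,\theta_2)$ is the subalgebra of $\mathbb A^{2^3}$ generated by all $\operatorname{cube}_i^3(a,b)$ with $i\in 3$, $\langle a,b\rangle\in\theta_i$. For $m\in A^{2^3}$, $j\in 3$, a line of $m$ in direction $j$ is a pair $\langle m_f,m_g\rangle$ with $f,g$ agreeing off $j$, $f_j=0$, $g_j=1$; it is the $(j)$-pivot line if the two other coordinates both equal $1$, and a $(j)$-supporting line otherwise. $C(\theta_0,\theta_1,\theta_2;j;\delta)$ means: for all $m\in M(\theta_0,\theta_1,\theta_2)$, if all $(j)$-supporting lines of $m$ are in $\delta$ then the $(j)$-pivot line is in $\delta$. In a congruence modular variety this is known not to depend on $j$; $[\theta_0,\theta_1,\theta_2]$ is the least $\delta\in\operatorname{Con}(\mathbb A)$ for which it holds. The relation $\Delta$. The congruence $\theta_0$ is regarded as a subalgebra of $\mathbb A^2$. $\Delta_{\theta_0,\theta_1}$ is the congruence of the algebra $\theta_0$ generated by all $\langle\langle x,x\rangle,\langle y,y\rangle\rangle$ with $\langle x,y\rangle\in\theta_1$. An element $\langle\langle a,b\rangle,\langle c,d\rangle\rangle\in\Delta_{\theta_0,\theta_1}$ is identified with the $h\in A^{2^2}$ with $h_{(0,0)}=a$,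 $h_{(1,0)}=b$, $h_{(0,1)}=c$, $h_{(1,1)}=d$, so $\Delta_{\theta_0,\theta_1}$ is a subalgebra of $\mathbb A^{2^2}$. Such an $h$ is written $\begin{bmatrix} c & d \\ a & b \end{bmatrix}$ (coordinate $0$ horizontal, coordinate $1$ vertical, origin at bottom left). $\Delta_{\theta_0,\theta_1,\theta_2}$ is the congruence of the algebra $\Delta_{\theta_0,\theta_1}$ generated by all pairs of constant squares $\left\langle\begin{bmatrix} x & x \\ x & x \end{bmatrix},\begin{bmatrix} y & y \\ y & y \end{bmatrix}\right\rangle$ with $\langle x,y\rangle\in\theta_2$. *)

(* Defs.v *)
From Stdlib Require Import RelationClasses.
From mathcomp Require Import all_boot.

Set Implicit Arguments.
Unset Strict Implicit.
Unset Printing Implicit Defensive.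

Record signature := Signature { symbol : Type; arity : symbol -> nat }.

(* Carriers may be empty.  A class of nonempty algebras closed under H, S, P
   stays so closed when the empty algebra (if the signature has one) is added,
   and its congruence lattice is trivial, so varieties are not affected. *)
Record algebra (sg : signature) := Algebra {
  carrier :> Type;
  op : forall s : symbol sg, ('I_(arity s) -> carrier) -> carrier }.

Definition is_hom (sg : signature) (A B : algebra sg) (f : A -> B) : Prop :=
  forall (s : symbol sg) (a : 'I_(arity s) -> A),
    f (op a) = op (fun i => f (a i)).

Definition prod_alg (sg : signature) (I : Type) (F : I -> algebra sg) :
  algebra sg :=
  @Algebra sg (forall i, F i)
    (fun s (a : 'I_(arity s) -> forall i, F i) i => op (fun k => a k i)).

Definition power (sg : signature) (I : Type) (A : algebra sg) : algebra sg :=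
  prod_alg (fun _ : I => A).

Record subalgebra (sg : signature) (A : algebra sg) := Subalgebra {
  sub_mem :> A -> Prop;
  sub_op : forall (s : symbol sg) (a : 'I_(arity s) -> A),
    (forall i, sub_mem (a i)) -> sub_mem (op a) }.

Definition subalg (sg : signature) (A : algebra sg) (U : subalgebra A) :
  algebra sg :=
  @Algebra sg {x : A | U x}
    (fun s a => exist _ (op (fun i => sval (a i)))
                        (sub_op (fun i => proj2_sig (a i)))).

Lemma Sg_op (sg : signature) (A : algebra sg) (X : A -> Prop)
    (s : symbol sg) (a : 'I_(arity s) -> A) :
  (forall i (U : subalgebra A), (forall x, X x -> U x) -> U (a i)) ->
  forall U : subalgebra A, (forall x, X x -> U x) -> U (op a).
Proof. by move=> Xa U XU; apply: sub_op => i; apply: Xa. Qed.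

(* The subalgebra generated by X. *)
Definition Sg (sg : signature) (A : algebra sg) (X : A -> Prop) :
  subalgebra A :=
  @Subalgebra sg A (fun x => forall U : subalgebra A, (forall y, X y -> U y) -> U x)
    (@Sg_op sg A X).

Record congruence (sg : signature) (A : algebra sg) := Congruence {
  con_rel :> A -> A -> Prop;
  con_equiv : Equivalence con_rel;
  con_op : forall (s : symbol sg) (a b : 'I_(arity s) -> A),
    (forall i, con_rel (a i) (b i)) -> con_rel (op a) (op b) }.

Lemma con_inf_equiv (sg : signature) (A : algebra sg)
    (P : congruence A -> Prop) :
  Equivalence (fun x y => forall d : congruence A, P d -> d x y).
Proof.
split=> [x d _|x y xy d Pd|x y z xy yz d Pd]; have [r s t] := con_equiv d.
- exact: r.
- exact/s/xy.
- exact: t (xy d Pd) (yz d Pd).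
Qed.

Lemma con_inf_op (sg : signature) (A : algebra sg)
    (P : congruence A -> Prop) (s : symbol sg) (a b : 'I_(arity s) -> A) :
  (forall i (d : congruence A), P d -> d (a i) (b i)) ->
  forall d : congruence A, P d -> d (op a) (op b).
Proof. by move=> ab d Pd; apply: con_op => i; apply: ab. Qed.

(* The infimum in Con(A) of the congruences satisfying P. *)
Definition con_inf (sg : signature) (A : algebra sg)
  (P : congruence A -> Prop) : congruence A :=
  @Congruence sg A (fun x y => forall d : congruence A, P d -> d x y)
    (con_inf_equiv P) (@con_inf_op sg A P).

(* The congruence generated by R. *)
Definition Cg (sg : signature) (A : algebra sg) (R : A -> A -> Prop) :
  congruence A := con_inf (fun d => forall x y, R x y -> d x y).

Definition con_join (sg : signature) (A : algebra sg) (al be : congruence A) :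
  congruence A := Cg (fun x y => al x y \/ be x y).

Lemma con_meet_equiv (sg : signature) (A : algebra sg) (al be : congruence A) :
  Equivalence (fun x y => al x y /\ be x y).
Proof.
have [ra sa ta] := con_equiv al; have [rb sb tb] := con_equiv be.
split=> [x|x y [xy xy']|x y z [xy xy'] [yz yz']]; split.
- exact: ra.
- exact: rb.
- exact: sa.
- exact: sb.
- exact: ta xy yz.
- exact: tb xy' yz'.
Qed.

Lemma con_meet_op (sg : signature) (A : algebra sg) (al be : congruence A)
    (s : symbol sg) (a b : 'I_(arity s) -> A) :
  (forall i, al (a i) (b i) /\ be (a i) (b i)) ->
  al (op a) (op b) /\ be (op a) (op b).
Proof. by move=> ab; split; apply: con_op => i; case: (ab i). Qed.

Definition con_meet (sg : signature) (A : algebra sg) (al be : congruence A) :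
  congruence A :=
  @Congruence sg A (fun x y => al x y /\ be x y)
    (con_meet_equiv al be) (@con_meet_op sg A al be).

Definition con_modular (sg : signature) (A : algebra sg) : Prop :=
  forall al be ga : congruence A,
    (forall x y, al x y -> ga x y) ->
    forall x y, con_join al (con_meet be ga) x y <->
                con_meet (con_join al be) ga x y.

Record variety (sg : signature) (V : algebra sg -> Prop) : Prop := Variety {
  variety_H : forall (A B : algebra sg) (f : A -> B),
    V A -> is_hom f -> (forall b, exists a, f a = b) -> V B;
  variety_S : forall (A : algebra sg) (U : subalgebra A), V A -> V (subalg U);
  variety_P : forall (I : Type) (F : I -> algebra sg),
    (forall i, V (F i)) -> V (prod_alg F) }.

Definition congruence_modular (sg : signature) (V : algebra sg -> Prop) :
  Prop := forall A : algebra sg, V A -> con_modular A.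

(* The elements 0 and 1 of the set 2 are [false] and [true], so that 2^n is
   {ffun 'I_n -> bool} and A^(2^n) is [power (vertex n) A]. *)
Definition vertex (n : nat) := {ffun 'I_n -> bool}.

Definition cube (T : Type) (i : 'I_3) (a b : T) : vertex 3 -> T :=
  fun f => if f i then b else a.

Definition M (sg : signature) (A : algebra sg) (t0 t1 t2 : congruence A) :
  subalgebra (power (vertex 3) A) :=
  @Sg sg (power (vertex 3) A)
    (fun m => exists (i : 'I_3) (a b : A),
       tnth [tuple t0; t1; t2] i a b /\ m = cube i a b).

(* The edge from f to g gives the line <m f, m g> of m in direction j. *)
Definition edge (j : 'I_3) (f g : vertex 3) : Prop :=
  [/\ f j = false, g j = true & forall i, i != j -> f i = g i].

Definition pivot (j : 'I_3) (f : vertex 3) : Prop :=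
  forall i, i != j -> f i = true.

Definition centralizes (sg : signature) (A : algebra sg)
  (t0 t1 t2 : congruence A) (j : 'I_3) (d : congruence A) : Prop :=
  forall m : power (vertex 3) A, M t0 t1 t2 m ->
    (forall f g, edge j f g -> ~ pivot j f -> d (m f) (m g)) ->
    forall f g, edge j f g -> pivot j f -> d (m f) (m g).

(* The least d with [centralizes t0 t1 t2 j d].  In a congruence modular
   variety it does not depend on j. *)
Definition commutator (sg : signature) (A : algebra sg) (j : 'I_3)
  (t0 t1 t2 : congruence A) : congruence A :=
  con_inf (centralizes t0 t1 t2 j).

Lemma commutator_least (sg : signature) (A : algebra sg) (j : 'I_3)
    (t0 t1 t2 : congruence A) :
  centralizes t0 t1 t2 j (commutator j t0 t1 t2) /\
  forall d : congruence A, centralizes t0 t1 t2 j d ->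
    forall x y, commutator j t0 t1 t2 x y -> d x y.
Proof.
split=> [m Mm supp f g efg pf d Cd|d Cd x y]; last exact.
by apply: (Cd m Mm) => // f' g' e np; apply: (supp f' g' e np).
Qed.

(* A relation on a subalgebra, as a relation between elements of the
   ambient algebra. *)
Definition ambient (sg : signature) (A : algebra sg) (U : subalgebra A)
  (R : subalg U -> subalg U -> Prop) (x y : A) : Prop :=
  exists (Ux : U x) (Uy : U y), R (exist _ x Ux) (exist _ y Uy).

Lemma ambient_op (sg : signature) (A : algebra sg) (U : subalgebra A)
    (R : congruence (subalg U)) (s : symbol sg) (a b : 'I_(arity s) -> A) :
  (forall i, ambient R (a i) (b i)) -> ambient R (op a) (op b).
Proof.
move=> ab.
pose Ua i : U (a i) := let: ex_intro Ux _ := ab i in Ux.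
pose Ub i : U (b i) := let: ex_intro _ (ex_intro Uy _) := ab i in Uy.
exists (sub_op Ua), (sub_op Ub).
pose a' i : subalg U := exist _ (a i) (Ua i).
pose b' i : subalg U := exist _ (b i) (Ub i).
apply: (@con_op _ _ R s a' b') => i.
by rewrite /a' /b' /Ua /Ub; case: (ab i) => Ux [Uy].
Qed.

(* The congruence of U <= A^I generated by the pairs of constant functions
   with values related by t. *)
Definition Cg_const (sg : signature) (I : Type) (A : algebra sg)
  (U : subalgebra (power I A)) (t : congruence A) : congruence (subalg U) :=
  @Cg sg (subalg U) (fun p q => exists x y : A,
    [/\ t x y, sval p = (fun=> x) & sval q = (fun=> y)]).

Lemma con_subalgebra_op (sg : signature) (A : algebra sg) (t : congruence A)
    (s : symbol sg) (a : 'I_(arity s) -> power bool A) :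
  (forall i, t (a i false) (a i true)) -> t (op a false) (op a true).
Proof. by move=> ta; apply: (con_op (c := t)). Qed.

(* A congruence as a subalgebra of A^2; the pair <a, b> is the function
   mapping false to a and true to b. *)
Definition con_subalgebra (sg : signature) (A : algebra sg)
  (t : congruence A) : subalgebra (power bool A) :=
  @Subalgebra sg (power bool A) (fun p => t (p false) (p true))
    (@con_subalgebra_op sg A t).

Definition Delta2_con (sg : signature) (A : algebra sg)
  (t0 t1 : congruence A) : congruence (subalg (con_subalgebra t0)) :=
  Cg_const (con_subalgebra t0) t1.

(* The row of h at height j; h is identified with <row h 0, row h 1>. *)
Definition row (T : Type) (h : vertex 2 -> T) (j : bool) : bool -> T :=
  fun i => h [ffun k : 'I_2 => if k == ord0 then i else j].

Lemma Delta2_op (sg : signature) (A : algebra sg) (t0 t1 : congruence A)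
    (s : symbol sg) (a : 'I_(arity s) -> power (vertex 2) A) :
  (forall i, ambient (Delta2_con t0 t1) (row (a i) false) (row (a i) true)) ->
  ambient (Delta2_con t0 t1) (row (op a) false) (row (op a) true).
Proof. exact: (@ambient_op sg (power bool A)). Qed.

Definition Delta2 (sg : signature) (A : algebra sg) (t0 t1 : congruence A) :
  subalgebra (power (vertex 2) A) :=
  @Subalgebra sg (power (vertex 2) A)
    (fun h => ambient (Delta2_con t0 t1) (row h false) (row h true))
    (@Delta2_op sg A t0 t1).

Definition Delta3_con (sg : signature) (A : algebra sg)
  (t0 t1 t2 : congruence A) : congruence (subalg (Delta2 t0 t1)) :=
  Cg_const (Delta2 t0 t1) t2.

Definition Delta3 (sg : signature) (A : algebra sg) (t0 t1 t2 : congruence A) :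
  (vertex 2 -> A) -> (vertex 2 -> A) -> Prop :=
  ambient (Delta3_con t0 t1 t2).

(* Coordinate 0 is horizontal, coordinate 1 vertical, and a is at (0, 0). *)
Definition square (T : Type) (c d a b : T) : vertex 2 -> T :=
  fun f => if f ord_max then (if f ord0 then d else c)
           else (if f ord0 then b else a).

Notation "[ 'sq' c , d ; a , b ]" := (square c d a b)
  (at level 0, c at level 99, d at level 99, a at level 99, b at level 99,
   format "[ 'sq'  c ,  d ;  a ,  b ]").

(* Main.v *)
From Stdlib Require Import RelationClasses FunctionalExtensionality ProofIrrelevance.
Require Import Defs.
From mathcomp Require Import all_boot.

(* Only the modular law in subalgebras of powers is used; no Day terms.
   Applied to a tolerance T viewed as a subalgebra of the square, it shows that
   (T o T) /\ be lies in every congruence containing T /\ be, hence so does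
   Cg T /\ be.  Consequently, if a set R of cubes is centralized modulo d in one
   direction j, so is its closure under gluing in direction j; a further use of
   the modular law, now for the congruence on faces given by that closure,
   carries centrality over to every other direction.  Closing M in direction 1
   and then in direction 2 yields a set of cubes containing Delta3, so every
   commutator centralizes Delta3 in all directions: (3), (4) and (5) imply (1).
   Conversely the shifting lemma for coordinate projections shows that (2)
   defines a congruence, that entries of a square in Delta2 may be replaced by
   entries related by it, and hence that it centralizes M in direction 2. *)

Set Implicit Arguments.
Unset Strict Implicit.
Unset Printing Implicit Defensive.

(** * Congruences generated by tolerances *)

Section Congruences.
Context {sg : signature}.
Implicit Types A B : algebra sg.

Lemma con_refl A (d : congruence A) x : d x x.
Proof. by case: (con_equiv d). Qed.

Lemma con_sym A (d : congruence A) x y : d x y -> d y x.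
Proof. by case: (con_equiv d) => _ s _; apply: s. Qed.

Lemma con_trans A (d : congruence A) y x z : d x y -> d y z -> d x z.
Proof. by case: (con_equiv d) => _ _ t; apply: t. Qed.

Lemma Cg_gen A (X : A -> A -> Prop) x y : X x y -> Cg X x y.
Proof. by move=> Xxy d; apply. Qed.

Lemma preim_con_equiv A B (f : A -> B) (d : congruence B) :
  Equivalence (fun x y => d (f x) (f y)).
Proof.
split=> [x|x y|x y z]; [exact: con_refl|exact: con_sym|exact: con_trans].
Qed.

Lemma preim_con_op A B (f : A -> B) (fh : is_hom f) (d : congruence B)
    (s : symbol sg) (a b : 'I_(arity s) -> A) :
  (forall i, d (f (a i)) (f (b i))) -> d (f (op a)) (f (op b)).
Proof. by move=> dab; rewrite !fh; apply: con_op. Qed.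

Definition preim_con A B (f : A -> B) (fh : is_hom f) (d : congruence B) :
  congruence A :=
  Congruence (preim_con_equiv f d) (@preim_con_op A B f fh d).

Lemma Cg_hom A B (f : A -> B) (X : A -> A -> Prop) (Y : B -> B -> Prop) :
  is_hom f -> (forall x y, X x y -> Y (f x) (f y)) ->
  forall x y, Cg X x y -> Cg Y (f x) (f y).
Proof.
move=> fh XY x y Xxy.
by apply: (Xxy (preim_con fh (Cg Y))) => u v /XY; apply: Cg_gen.
Qed.

Lemma eq_con_equiv A : Equivalence (@eq A).
Proof. by split=> // x y z ->. Qed.

Lemma eq_con_op A (s : symbol sg) (a b : 'I_(arity s) -> A) :
  (forall i, a i = b i) -> op a = op b.
Proof. by move=> /functional_extensionality ->. Qed.

Definition eq_con A : congruence A := Congruence (eq_con_equiv A) (@eq_con_op A).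

Lemma coord_con_equiv (I : Type) A (U : subalgebra (power I A))
    (d : congruence A) (P : I -> Prop) :
  Equivalence (fun u v : subalg U => forall i, P i -> d (sval u i) (sval v i)).
Proof.
split=> [u i _|u v uv i Pi|u v w uv vw i Pi].
- exact: con_refl.
- exact/con_sym/uv.
- exact: con_trans (uv i Pi) (vw i Pi).
Qed.

Lemma coord_con_op (I : Type) A (U : subalgebra (power I A))
    (d : congruence A) (P : I -> Prop) (s : symbol sg)
    (a b : 'I_(arity s) -> subalg U) :
  (forall k i, P i -> d (sval (a k) i) (sval (b k) i)) ->
  forall i, P i -> d (sval (op a) i) (sval (op b) i).
Proof. by move=> ab i Pi; apply: (con_op (c := d)) => k; apply: ab. Qed.

(* For d the equality this is the kernel of the projection to P. *)
Definition coord_con (I : Type) A (U : subalgebra (power I A))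
    (d : congruence A) (P : I -> Prop) : congruence (subalg U) :=
  Congruence (coord_con_equiv U d P) (@coord_con_op I A U d P).

Lemma join_l A (al be : congruence A) x y : al x y -> con_join al be x y.
Proof. by move=> h; apply: Cg_gen; left. Qed.

Lemma join_r A (al be : congruence A) x y : be x y -> con_join al be x y.
Proof. by move=> h; apply: Cg_gen; right. Qed.

Lemma join_sub A (al be d : congruence A) :
  (forall x y, al x y -> d x y) -> (forall x y, be x y -> d x y) ->
  forall x y, con_join al be x y -> d x y.
Proof. by move=> ald bed x y; apply=> u v [/ald|/bed]. Qed.

(** The working form of the modular law: as [al] lies below [ga], the meet of [con_join al be] with
    [ga] is the join of [al] with [be] meet [ga], and [d] need only contain these two. *)
Lemma modular_sub A (al be ga d : congruence A) : con_modular A ->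
  (forall x y, al x y -> ga x y) ->
  (forall x y, al x y -> d x y) ->
  (forall x y, be x y -> ga x y -> d x y) ->
  forall x y, con_join al be x y -> ga x y -> d x y.
Proof.
move=> mA alga ald begad x y jxy gxy.
have/(mA _ _ _ alga) := conj jxy gxy : con_meet (con_join al be) ga x y.
by apply: join_sub => // u v []; apply: begad.
Qed.

Definition eq_clos T (X : T -> T -> Prop) (x y : T) : Prop :=
  forall E : T -> T -> Prop,
    Equivalence E -> (forall u v, X u v -> E u v) -> E x y.

Lemma eq_clos_equiv T (X : T -> T -> Prop) : Equivalence (eq_clos X).
Proof.
split=> [x E [r _ _] _|x y xy E Eq XE|x y z xy yz E Eq XE].
- exact: r.
- by case: (Eq) => _ s _; apply: s; apply: xy.
- by case: (Eq) => _ _ t; apply: (t x y z); [apply: xy|apply: yz].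
Qed.

Definition upd (I : eqType) T (h : I -> T) (i : I) (v : T) : I -> T :=
  fun k => if k == i then v else h k.

Definition translation_closed A (X : A -> A -> Prop) : Prop :=
  forall (s : symbol sg) (a : 'I_(arity s) -> A) i u v,
    X u v -> X (op (upd a i u)) (op (upd a i v)).

(** The equivalence closure inherits stability under basic translations, so arguments can be changed
    one at a time and the closure is already a congruence. *)
Lemma eq_clos_op A (X : A -> A -> Prop) : translation_closed X ->
  forall (s : symbol sg) (a b : 'I_(arity s) -> A),
  (forall i, eq_clos X (a i) (b i)) -> eq_clos X (op a) (op b).
Proof.
move=> Xt s a b ab; have [r _ t] := eq_clos_equiv X.
have step (c : 'I_(arity s) -> A) i u v :
    eq_clos X u v -> eq_clos X (op (upd c i u)) (op (upd c i v)).
  move=> /(_ (fun u v => eq_clos X (op (upd c i u)) (op (upd c i v)))); apply.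
    case: (eq_clos_equiv X) => r' s' t'.
    by split=> [w|w w'|w w' w'']; [apply: r'|apply: s'|apply: t'].
  by move=> u' v' /(Xt _ c i) Xuv E _; apply.
(* [hyb k] has its first [k] arguments exchanged already, so it leads from [a] to [b] in [arity s]
   translations. *)
pose hyb k : 'I_(arity s) -> A := fun i => if i < k then b i else a i.
have hyb0 : hyb 0 = a by [].
have hybn : hyb (arity s) = b.
  by apply: functional_extensionality => i; rewrite /hyb ltn_ord.
rewrite -hybn -hyb0; elim: {-2}(arity s) (leqnn (arity s)) => // k IH lek.
apply: t (IH (ltnW lek)) _.
suff <- : upd (hyb k) (Ordinal lek) (a (Ordinal lek)) = hyb k.
  suff -> : hyb k.+1 = upd (hyb k) (Ordinal lek) (b (Ordinal lek)).
    by apply: step; apply: ab.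
  apply: functional_extensionality => i; rewrite /hyb /upd ltnS leq_eqVlt -val_eqE /=.
  by case: eqP => //= ik; congr b; apply: val_inj.
apply: functional_extensionality => i; rewrite /hyb /upd.
by case: eqP => // ->; rewrite ltnn.
Qed.

Lemma Cg_eq_clos A (X : A -> A -> Prop) : translation_closed X ->
  forall x y, Cg X x y -> eq_clos X x y.
Proof.
move=> Xt x y.
move/(_ (Congruence (eq_clos_equiv X) (eq_clos_op Xt))); apply.
by move=> u v Xuv E _; apply.
Qed.

Lemma con_translation A (d : congruence A) : translation_closed d.
Proof.
move=> s a i u v duv; apply: con_op => k; rewrite /upd.
by case: eqP => // _; apply: con_refl.
Qed.

(** A union of two congruences is translation closed, so its join consists of finite chains of [al]-
    and [be]-steps; this is induction along such a chain. *)
Lemma join_invariant A (al be : congruence A) (P : A -> Prop) :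
  (forall u v, P u -> al u v \/ be u v -> P v) ->
  forall x y, con_join al be x y -> P x -> P y.
Proof.
move=> Pstep x y.
have Xt : translation_closed (fun x y => al x y \/ be x y).
  by move=> s a i u v [h|h]; [left|right]; apply: con_translation.
move/(Cg_eq_clos Xt)/(_ (fun u v => P u <-> P v)) => PE.
move=> Px; suff [Pxy _] : P x <-> P y by apply: Pxy.
apply: PE => [|u v Xuv].
  by split=> [u|u v [uv vu]|u v w [uv vu] [vw wv]]; split; auto.
split=> [Pu|Pv]; first exact: Pstep Pu Xuv.
by apply: Pstep Pv _; case: Xuv => /con_sym; [left|right].
Qed.

Record tolerance A (T : A -> A -> Prop) : Prop := Tolerance {
  tol_refl : forall x, T x x;
  tol_sym : forall x y, T x y -> T y x;
  tol_op : forall (s : symbol sg) (a b : 'I_(arity s) -> A),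
    (forall i, T (a i) (b i)) -> T (op a) (op b) }.

Definition tol_sq A (T : A -> A -> Prop) : A -> A -> Prop :=
  fun x y => exists2 z, T x z & T z y.

Lemma tol_sqP A (T : A -> A -> Prop) : tolerance T -> tolerance (tol_sq T).
Proof.
case=> r sy o; split=> [x|x y [z xz zy]|s a b ab]; first by exists x.
  by exists z; apply: sy.
have [c acb] := fin_all_exists (fun i => let: ex_intro2 z p q := ab i in
  ex_intro (fun z => T (a i) z /\ T z (b i)) z (conj p q)).
by exists (op c); apply: o => i; case: (acb i).
Qed.

(** Reflexivity makes the iterated squares of [T] increase, so their union is transitive and absorbs
    the equivalence closure of [T]. *)
Lemma Cg_tol_iter A (T : A -> A -> Prop) : tolerance T ->
  forall x y, Cg T x y -> exists n, iter n (@tol_sq A) T x y.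
Proof.
move=> tT x y; have Xt : translation_closed T.
  move=> s a i u v Tuv; apply: (tol_op tT) => k; rewrite /upd.
  by case: eqP => // _; apply: (tol_refl tT).
move/(Cg_eq_clos Xt)/(_ (fun u v => exists n, iter n (@tol_sq A) T u v)).
apply; last by move=> u v Tuv; exists 0.
have tn n : tolerance (iter n (@tol_sq A) T).
  by elim: n => //= n; apply: tol_sqP.
have mon m n u v : iter n (@tol_sq A) T u v -> iter (m + n) (@tol_sq A) T u v.
  elim: m => // m IH /IH h; rewrite addSn /=; exists u => //.
  exact: (tol_refl (tn _)).
split=> [u|u v [n h]|u v w [n h] [m k]]; first by exists 0; apply: (tol_refl tT).
  by exists n; apply: (tol_sym (tn n)).
(* Both halves are lifted to level [m + n]; one more squaring composes them. *)
exists (m + n).+1; exists v; first exact: mon.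
by rewrite addnC; apply: mon.
Qed.

Lemma sub_congr A (U : subalgebra A) (u v : subalg U) :
  sval u = sval v -> u = v.
Proof. by apply: eq_sig_hprop => *; apply: proof_irrelevance. Qed.

(** * Tolerances and shifting under the modular law *)

Section Modular.
Variable V : algebra sg -> Prop.
Hypotheses (V_variety : variety V) (V_modular : congruence_modular V).

Lemma power_sub_modular (I : Type) A (U : subalgebra (power I A)) :
  V A -> con_modular (subalg U).
Proof.
move=> VA; apply: V_modular; apply: (variety_S V_variety).
exact: (variety_P V_variety).
Qed.

(** In the algebra [U] of pairs in [T], the modular law replaces the path from [(x,x)] to [(y,y)]
    through [z] by one whose pairs have both entries [be]-related to [x]. Such pairs lie in [T] meet
    [be], hence in [ga]. *)
Lemma tol_sq_meet A (T : A -> A -> Prop) (be ga : congruence A) :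
  V A -> tolerance T -> (forall x y, T x y -> be x y -> ga x y) ->
  forall x y, tol_sq T x y -> be x y -> ga x y.
Proof.
move=> VA tT Tbg x y [z xz zy] bxy.
pose pr (u v : A) : power bool A := fun b => if b then v else u.
have Tsub (s : symbol sg) (a : 'I_(arity s) -> power bool A) :
    (forall i, T (a i false) (a i true)) -> T (op a false) (op a true).
  by move=> h; apply: (tol_op tT).
pose U := @Subalgebra sg (power bool A) (fun p => T (p false) (p true)) Tsub.
pose mk u v (h : T u v) : subalg U := exist _ (pr u v) h.
pose co d b := @coord_con bool A U d (fun b' => b' = b).
pose al := con_meet (co be false) (co (eq_con A) true).
pose et := co (eq_con A) false.
pose bb := @coord_con bool A U be (fun=> True).
have rT := tol_refl tT.
(* The path is [(x,x)], [(x,z)], [(y,z)], [(y,y)]: the outer steps keep the first entry, the middle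
   one keeps the second. *)
have j1 : con_join al et (mk x x (rT x)) (mk y y (rT y)).
  apply: (@con_trans _ _ (mk x z xz)); first by apply: join_r => b /= ->.
  apply: (@con_trans _ _ (mk y z (tol_sym tT zy))).
    by apply: join_l; split=> b /= ->.
  by apply: join_r => b /= ->.
have j2 : bb (mk x x (rT x)) (mk y y (rT y)) by move=> [].
have albb u v : al u v -> bb u v.
  case=> h0 h1 [] _; last exact: h0.
  by rewrite (h1 true erefl : _ = _); apply: con_refl.
have [_ /(_ (conj j1 j2)) jxy] :=
  @power_sub_modular bool A U VA al et bb albb (mk x x (rT x)) (mk y y (rT y)).
pose P (u : subalg U) := [/\ be x (sval u false), be x (sval u true),
  ga x (sval u false) & ga x (sval u true)].
suff [] : P (mk y y (rT y)) by [].
apply: (join_invariant _ jxy) => [u v [b0 b1 g0 g1] uv|]; last first.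
  by split=> /=; apply: con_refl.
have Puv (w : subalg U) : be x (sval w false) -> be x (sval w true) ->
    ga (sval w false) (sval w true).
  move=> w0 w1; apply: Tbg (svalP w) _.
  exact: con_trans (con_sym w0) w1.
have [v0 v1] : be x (sval v false) /\ be x (sval v true).
  have buv : bb u v by case: uv => [/albb|[]].
  split; [exact: con_trans b0 (buv false I)|exact: con_trans b1 (buv true I)].
have gv := Puv v v0 v1.
(* An [al]-step fixes the second entry, an [et]-step the first. The fixed entry stays [ga]-related
   to [x], and [gv] passes this on to the other entry. *)
case: uv => [[_ /(_ true erefl) e]|[/(_ false erefl) e _]]; rewrite /= in e.
  split=> //; rewrite -?e //; apply: (con_trans g1); rewrite e; exact: con_sym.
by split=> //; rewrite -?e //; apply: (con_trans g0); rewrite e.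
Qed.

(* The tolerance intersection property. *)
Lemma Cg_tol_meet A (T : A -> A -> Prop) (be ga : congruence A) :
  V A -> tolerance T -> (forall x y, T x y -> be x y -> ga x y) ->
  forall x y, Cg T x y -> be x y -> ga x y.
Proof.
move=> VA tT Tbg x y /(Cg_tol_iter tT) [n].
elim: n x y => [|n IH] //= x y; apply: tol_sq_meet => //.
by elim: n {IH} => //= n; apply: tol_sqP.
Qed.

(* The shifting lemma for the kernel of the projection to coordinate i and
   the kernel of the projection to the others, whose meet is trivial. *)
Lemma shift (I : eqType) A (U : subalgebra (power I A))
    (D : congruence (subalg U)) i (u v u' v' : subalg U) : V A ->
  (forall k, k != i -> sval u k = sval v k) ->
  (forall k, k != i -> sval u' k = sval v' k) ->
  sval u i = sval u' i -> sval v i = sval v' i -> D u v -> D u' v'.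
Proof.
move=> VA uv u'v' uu' vv' Duv.
pose ga := @coord_con I A U (eq_con A) (fun k => k != i).
pose be := @coord_con I A U (eq_con A) (fun k => k = i).
apply: (modular_sub (al := con_meet D ga) (be := be) (ga := ga)) => //.
- exact: power_sub_modular.
- by move=> w w' [].
- by move=> w w' [].
- move=> w w' h1 h2.
  suff -> : w = w' by apply: con_refl.
  apply/sub_congr; apply: functional_extensionality => k.
  by case: (eqVneq k i) => [->|/h2 //]; apply: h1.
(* The path [u'], [u], [v], [v'] has a step in [D] meet [ga] between two [be]-steps. *)
- apply: (@con_trans _ _ u); first by apply: join_r => k /= ->.
  apply: (@con_trans _ _ v); first by apply: join_l; split.
  by apply: join_r => k /= ->.
Qed.
End Modular.
End Congruences.

(** * Gluing of cubes *)

Section Cubes.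
Context {sg : signature}.
Implicit Types A : algebra sg.

Definition setv n (j : 'I_n) (b : bool) (f : vertex n) : vertex n :=
  [ffun i => if i == j then b else f i].

Definition flip n (j : 'I_n) (f : vertex n) : vertex n :=
  [ffun i => if i == j then ~~ f i else f i].

Lemma setv_at n (j : 'I_n) b f : setv j b f j = b.
Proof. by rewrite ffunE eqxx. Qed.

Lemma setv_off n (i j : 'I_n) b f : i != j -> setv j b f i = f i.
Proof. by rewrite ffunE => /negbTE ->. Qed.

Lemma setv_id n (j : 'I_n) b (f : vertex n) : f j = b -> setv j b f = f.
Proof. by move=> fj; apply/ffunP => i; rewrite ffunE; case: eqP => // ->. Qed.

Lemma setv_setv n (j : 'I_n) b c f : setv j b (setv j c f) = setv j b f.
Proof. by apply/ffunP => i; rewrite !ffunE; case: eqP. Qed.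

Lemma setvC n (i j : 'I_n) b c f : i != j ->
  setv j b (setv i c f) = setv i c (setv j b f).
Proof.
move=> ij; apply/ffunP => k; rewrite !ffunE; case: eqP => // ->.
by rewrite eq_sym (negbTE ij).
Qed.

Lemma setv_flip n (j : 'I_n) b f : setv j b (flip j f) = setv j b f.
Proof. by apply/ffunP => i; rewrite !ffunE; case: eqP. Qed.

Lemma flip_setv n (j : 'I_n) b f : flip j (setv j b f) = setv j (~~ b) f.
Proof. by apply/ffunP => i; rewrite !ffunE; case: eqP. Qed.

(** Such an [s] acts as one and the same map on the two faces orthogonal to [j]. *)
Definition cube_map_off n (j : 'I_n) (s : vertex n -> vertex n) : Prop :=
  (forall b f, setv j b (s f) = s (setv j b f)) /\ (forall f, s f j = f j).

Lemma setv_off_dir n (i j : 'I_n) b : i != j -> cube_map_off j (setv i b).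
Proof.
by move=> ij; split=> [c f|f]; [exact: setvC|rewrite setv_off // eq_sym].
Qed.

Lemma flip_off_dir n (i j : 'I_n) : i != j -> cube_map_off j (flip i).
Proof.
move=> ij; split=> [c f|f]; last by rewrite ffunE eq_sym (negbTE ij).
apply/ffunP => k; rewrite !ffunE; do 2!case: eqP => // ?; subst.
by rewrite eqxx in ij.
Qed.

Definition closed_under A n (R : subalgebra (power (vertex n) A))
    (s : vertex n -> vertex n) : Prop :=
  forall m, R m -> R (m \o s).

(** Collapses will make adjacency reflexive, and reflections will make it symmetric. *)
Definition cubical A n (R : subalgebra (power (vertex n) A)) : Prop :=
  (forall j b, closed_under R (setv j b)) /\ (forall j, closed_under R (flip j)).

Definition glue A n (j : 'I_n) (h h' : vertex n -> A) : vertex n -> A :=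
  fun f => if f j then h' f else h f.

(* The elements h and h' of R represent their faces with j-coordinate 0. *)
Definition adjacent A n (j : 'I_n) (R : subalgebra (power (vertex n) A))
    (h h' : subalg R) : Prop :=
  R (glue j (sval h \o setv j false) (sval h' \o setv j false)).

Lemma glue_op A n (j : 'I_n) (s : symbol sg)
    (a b : 'I_(arity s) -> power (vertex n) A) :
  glue j (op a) (op b) = op (fun i => glue j (a i) (b i) : power (vertex n) A).
Proof.
by apply: functional_extensionality => f; rewrite /glue /=; case: (f j).
Qed.

Lemma adjacent_tolerance A n (j : 'I_n) (R : subalgebra (power (vertex n) A)) :
  cubical R -> tolerance (@adjacent A n j R).
Proof.
case=> Rf Rr; split=> [[h Rh]|[h Rh] [h' Rh']|s a b ab]; rewrite /adjacent /=.
- suff -> : glue j (h \o setv j false) (h \o setv j false) = h \o setv j false.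
    exact: Rf.
  by apply: functional_extensionality => f; rewrite /glue; case: (f j).
- move/(Rr j); congr (R _); apply: functional_extensionality => f.
  by rewrite /glue /= ffunE eqxx setv_flip; case: (f j).
- by move: (sub_op ab); rewrite -glue_op.
Qed.

Lemma star_op A n (j : 'I_n) (R : subalgebra (power (vertex n) A))
    (s : symbol sg) (a : 'I_(arity s) -> power (vertex n) A) :
  (forall i, ambient (Cg (@adjacent A n j R))
    (a i \o setv j false) (a i \o setv j true)) ->
  ambient (Cg (@adjacent A n j R)) (op a \o setv j false) (op a \o setv j true).
Proof. exact: (@ambient_op sg (power (vertex n) A)). Qed.

(* The closure of R under gluing cubes along common faces in direction j. *)
Definition star A n (j : 'I_n) (R : subalgebra (power (vertex n) A)) :
  subalgebra (power (vertex n) A) :=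
  @Subalgebra sg (power (vertex n) A)
    (fun m => ambient (Cg (@adjacent A n j R))
                (m \o setv j false) (m \o setv j true))
    (@star_op A n j R).

Lemma starE A n (j : 'I_n) (R : subalgebra (power (vertex n) A)) m :
  star j R m = ambient (Cg (@adjacent A n j R))
                 (m \o setv j false) (m \o setv j true).
Proof. by []. Qed.

Lemma ambient_refl A (U : subalgebra A) (D : congruence (subalg U)) x :
  U x -> ambient D x x.
Proof. by move=> Ux; exists Ux, Ux; apply: con_refl. Qed.

Lemma ambient_sym A (U : subalgebra A) (D : congruence (subalg U)) x y :
  ambient D x y -> ambient D y x.
Proof. by case=> Ux [Uy Dxy]; exists Uy, Ux; apply: con_sym. Qed.

Lemma ambient_trans A (U : subalgebra A) (D : congruence (subalg U)) y x z :
  ambient D x y -> ambient D y z -> ambient D x z.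
Proof.
case=> Ux [Uy Dxy] [Uy' [Uz Dyz]]; exists Ux, Uz; apply: con_trans Dxy _.
by rewrite (proof_irrelevance _ Uy Uy').
Qed.

(** The two faces of [m] orthogonal to [j], extended constantly along [j], are adjacent by virtue of
    [m] itself. *)
Lemma sub_star A n (j : 'I_n) (R : subalgebra (power (vertex n) A)) m :
  cubical R -> R m -> star j R m.
Proof.
case=> Rf Rr Rm; exists (Rf j false m Rm), (Rf j true m Rm); apply: Cg_gen.
rewrite /adjacent /=.
suff -> : glue j ((m \o setv j false) \o setv j false)
               ((m \o setv j true) \o setv j false) = m by [].
apply: functional_extensionality => f; rewrite /glue /= !setv_setv.
by case: ifPn => [|/negbTE] /setv_id ->.
Qed.

Lemma star_trans A n (j : 'I_n) (R : subalgebra (power (vertex n) A))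
    (h1 h2 h3 : vertex n -> A) :
  star j R (glue j (h1 \o setv j false) (h2 \o setv j false)) ->
  star j R (glue j (h2 \o setv j false) (h3 \o setv j false)) ->
  star j R (glue j (h1 \o setv j false) (h3 \o setv j false)).
Proof.
have gl (h h' : vertex n -> A) b :
    glue j (h \o setv j false) (h' \o setv j false) \o setv j b
    = (if b then h' else h) \o setv j false.
  apply: functional_extensionality => f.
  by rewrite /glue /= setv_at !setv_setv; case: b.
by rewrite !starE !gl => h12 h23; apply: ambient_trans h12 h23.
Qed.

Lemma hom_precomp A n (R : subalgebra (power (vertex n) A))
    (s : vertex n -> vertex n) (Rs : closed_under R s) :
  is_hom (fun h : subalg R =>
    exist _ (sval h \o s) (Rs _ (proj2_sig h)) : subalg R).
Proof. by move=> t a; apply: sub_congr. Qed.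

(** Precomposition with [s] is an endomorphism of [subalg R]. It preserves adjacency because [s] is
    compatible with gluing along [j], and so preserves the generated congruence. *)
Lemma adjacent_precomp A n (j : 'I_n) (R : subalgebra (power (vertex n) A))
    (s : vertex n -> vertex n) h h' : cube_map_off j s -> closed_under R s ->
  ambient (Cg (@adjacent A n j R)) h h' ->
  ambient (Cg (@adjacent A n j R)) (h \o s) (h' \o s).
Proof.
move=> [sC sj] Rs [Rh [Rh' hh']]; exists (Rs _ Rh), (Rs _ Rh').
apply: (Cg_hom (hom_precomp Rs) _ hh') => -[u Ru] [v Rv] /Rs.
congr (R _); apply: functional_extensionality => f.
by rewrite /glue /= sj sC.
Qed.

Lemma star_precomp A n (j : 'I_n) (R : subalgebra (power (vertex n) A))
    (s : vertex n -> vertex n) : cube_map_off j s -> closed_under R s ->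
  closed_under (star j R) s.
Proof.
move=> sj Rs m /(adjacent_precomp sj Rs); case: sj => sC _.
have e b : (m \o setv j b) \o s = (m \o s) \o setv j b.
  by apply: functional_extensionality => f /=; rewrite sC.
by rewrite !e.
Qed.

(** Along [j], a collapse makes both faces equal and a reflection swaps them, so reflexivity and
    symmetry suffice. In the other directions the closure is inherited from [R]. *)
Lemma star_cubical A n (j : 'I_n) (R : subalgebra (power (vertex n) A)) :
  cubical R -> cubical (star j R).
Proof.
move=> [Rf Rr]; split=> [k b|k]; case: (eqVneq k j) => [->|kj].
- move=> m [R0 [R1 _]]; rewrite starE.
  have e c : (m \o setv j b) \o setv j c = m \o setv j b.
    by apply: functional_extensionality => f /=; rewrite setv_setv.
  by rewrite !e; apply: ambient_refl; case: b {e}.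
- by apply: star_precomp => //; apply: setv_off_dir.
- move=> m /ambient_sym; rewrite !starE; congr ambient;
    by apply: functional_extensionality => f /=; rewrite flip_setv.
- by apply: star_precomp => //; apply: flip_off_dir.
Qed.

(** * Centrality of glued cubes *)

Definition pivotal (j : 'I_3) (f : vertex 3) : bool :=
  [forall i, (i != j) ==> f i].

Lemma pivotalP j f : reflect (pivot j f) (pivotal j f).
Proof.
apply: (iffP forallP) => [h i /(implyP (h i))|h i]; first by case: (f i).
by apply/implyP => /h.
Qed.

Lemma pivotal_setv j b f : pivotal j (setv j b f) = pivotal j f.
Proof.
by apply: eq_forallb => i; rewrite ffunE; case: eqP.
Qed.

(** The centralizing condition for an arbitrary set of cubes; a line is named by either of its
    vertices [f]. *)
Definition central A (R : subalgebra (power (vertex 3) A)) (j : 'I_3)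
    (d : congruence A) : Prop :=
  forall m, R m ->
    (forall f, ~~ pivotal j f -> d (m (setv j false f)) (m (setv j true f))) ->
    forall f, pivotal j f -> d (m (setv j false f)) (m (setv j true f)).

Section Modular.
Variable V : algebra sg -> Prop.
Hypotheses (V_variety : variety V) (V_modular : congruence_modular V).

(** Centrality says that adjacency together with [d] off the pivot forces [d] at the pivot;
    [Cg_tol_meet] carries this from the tolerance to the congruence it generates. Elements of [R]
    stand for their faces at [j]-coordinate 0, hence the restriction on [f j]. *)
Lemma star_central_dir A (R : subalgebra (power (vertex 3) A)) j d
    (u v : subalg R) :
  V A -> cubical R -> central R j d -> Cg (@adjacent A 3 j R) u v ->
  (forall f, ~~ pivotal j f -> ~~ f j -> d (sval u f) (sval v f)) ->
  (forall f, pivotal j f -> ~~ f j -> d (sval u f) (sval v f)).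
Proof.
move=> VA cR Rjd uv huv f pf f0.
pose co P := coord_con R d (fun f => P f /\ ~~ f j).
have VR : V (subalg R).
  by apply: (variety_S V_variety); apply: (variety_P V_variety).
apply: (Cg_tol_meet V_variety V_modular (be := co (fun f => ~~ pivotal j f))
  (ga := co (pivotal j)) VR (adjacent_tolerance j cR) _ uv) => //; last first.
  by move=> g [pg g0]; apply: huv.
move=> {uv huv f pf f0 u} {}u {}v uv huv f [pf f0].
have := Rjd _ uv _ f pf.
rewrite /glue /= !setv_at !setv_setv setv_id; last exact: negbTE.
apply=> g pg; rewrite !setv_at !setv_setv; apply: huv.
by rewrite pivotal_setv pg setv_at.
Qed.

(* For k <> j, let e collapse direction k and let h, h' be the faces of m at
   j = 0, 1.  Then e h' ~ e h and h ~ h' for the congruence ~ generated by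
   adjacency, and e h is d-related to h; by the modular law the relation between
   e h' and h' splits into d-steps and ~-steps that stay d-related off the
   pivot, and the latter are handled by centrality in direction j. *)
Lemma star_central A (R : subalgebra (power (vertex 3) A)) j k d :
  V A -> cubical R -> central R j d -> central (star j R) k d.
Proof.
move=> VA cR Rjd m [R0 [R1 m01]] supp f pf.
have dir := star_central_dir VA cR Rjd.
case: (eqVneq k j) pf supp => [->|kj] pf supp.
  have := dir _ _ m01 _ (setv j false f).
  rewrite pivotal_setv setv_at /= !setv_setv; apply=> // g pg g0.
  exact: supp.
have jk : j != k by rewrite eq_sym.
pose Ek := cR.1 k false.
pose h : subalg R := exist _ _ R0; pose h' : subalg R := exist _ _ R1.
pose e (u : subalg R) : subalg R := exist _ (sval u \o setv k false) (Ek _ (proj2_sig u)).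
pose al := coord_con R d (fun f => ~~ f j).
pose ga := coord_con R d (fun f => ~~ pivotal j f /\ ~~ f j).
pose de := coord_con R d (fun f => pivotal j f /\ ~~ f j).
have eh : Cg (@adjacent A 3 j R) (e h) (e h').
  apply: (Cg_hom (hom_precomp Ek) _ m01) => -[u Ru] [v Rv] /Ek.
  congr (R _); apply: functional_extensionality => g.
  by rewrite /glue /= setv_off // setvC.
have line g b : ~~ pivotal k (setv j b g) ->
    d (m (setv j b (setv k false g))) (m (setv j b g)).
  move=> /supp; rewrite setvC //; case gk: (g k).
    by rewrite (setv_id (b := true)) // setv_off.
  by rewrite (setv_id (b := false)) ?setv_off // => _; apply: con_refl.
have step : con_join al (Cg (@adjacent A 3 j R)) (e h') h'.
  apply: (@con_trans _ _ _ (e h)); first by apply/join_r/con_sym.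
  apply: (@con_trans _ _ _ h); last by apply: join_r.
  apply: join_l => g g0 /=; apply: line; apply/forallPn; exists j.
  by rewrite jk setv_at.
have eg : ga (e h') h'.
  move=> g [/forallPn /= [i]]; rewrite negb_imply => /andP[ij gi] g0.
  case gk: (g k); last by rewrite (setv_id (b := false) gk); apply: con_refl.
  apply: line; apply/forallPn; exists i; rewrite negb_imply setv_off // gi andbT.
  by apply: contraNneq gi => ->; rewrite gk.
have de' : de (e h') h'.
  apply: (modular_sub (power_sub_modular V_variety V_modular VA) _ _ _ step eg).
  - by move=> u v uv g [_ g0]; apply: uv.
  - by move=> u v uv g [_ g0]; apply: uv.
  - move=> u v uv guv g [pg g0]; apply: dir uv _ _ pg g0 => g' pg' g0'.
    exact: guv.
have fj b : setv j true (setv k b f) = setv k b f.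
  by apply: setv_id; rewrite setv_off //; move/pivotalP: pf => /(_ j jk).
(* [h'] shows the face of [m] at [j]-coordinate 1 and is read at [j]-coordinate 0. Setting [k] to 1
   makes the vertex pivotal for [j], and there [e h'] and [h'] take the values of [m] at the ends of
   its [k]-pivot line. *)
have := de' (setv j false (setv k true f)).
rewrite /= (setvC _ _ _ jk) !setv_setv !fj; apply; split; last by rewrite setv_at.
rewrite pivotal_setv; apply/pivotalP => i ij; rewrite ffunE.
by case: eqP => // /eqP ik; move/pivotalP: pf => /(_ i ik).
Qed.
End Modular.
End Cubes.

(** * Centrality of [Delta3] *)

Definition dir0 : 'I_3 := ord0.
Definition dir1 : 'I_3 := @Ordinal 3 1 isT.
Definition dir2 : 'I_3 := ord_max.

Definition base (f : vertex 3) : vertex 2 :=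
  [ffun k : 'I_2 => if k == ord0 then f dir0 else f dir1].

Lemma dirP (i : 'I_3) : [\/ i = dir0, i = dir1 | i = dir2].
Proof.
by case: i => [[|[|[|//]]] i3]; [constructor 1|constructor 2|constructor 3];
  apply: val_inj.
Qed.

Lemma pivotalE (f : vertex 3) :
  (pivotal dir0 f = f dir1 && f dir2) * (pivotal dir1 f = f dir0 && f dir2) *
  (pivotal dir2 f = f dir0 && f dir1).
Proof.
split; [split|]; apply/pivotalP/andP => [h|[h h'] i]; try (by split; apply: h);
  by case: (dirP i) => ->.
Qed.

Section DeltaCubes.
Context {sg : signature}.
Implicit Types A : algebra sg.

Lemma M_cube A (t0 t1 t2 : congruence A) (i : 'I_3) a b :
  tnth [tuple t0; t1; t2] i a b -> M t0 t1 t2 (cube i a b).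
Proof. by move=> ab U; apply; exists i, a, b. Qed.

(** The cubes [m] with [m \o s] in [M] form a subalgebra, so generators suffice. *)
Lemma M_precomp A (t0 t1 t2 : congruence A) (s : vertex 3 -> vertex 3) :
  (forall i a b, tnth [tuple t0; t1; t2] i a b ->
     M t0 t1 t2 (cube i a b \o s)) ->
  closed_under (M t0 t1 t2) s.
Proof.
move=> gen m Mm.
have op_s (o : symbol sg) (a : 'I_(arity o) -> power (vertex 3) A) :
    (forall i, M t0 t1 t2 (a i \o s)) -> M t0 t1 t2 (op a \o s).
  move=> Ma.
  exact: (@sub_op sg (power (vertex 3) A) (M t0 t1 t2) o (fun i => a i \o s) Ma).
move/(_ (@Subalgebra sg (power (vertex 3) A) (fun m => M t0 t1 t2 (m \o s)) op_s)): Mm.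
apply=> _ [i [a [b [ab ->]]]]; exact: gen.
Qed.

Lemma M_cubical A (t0 t1 t2 : congruence A) : cubical (M t0 t1 t2).
Proof.
split=> [j c|j]; apply: M_precomp => i a b ab.
- case: (eqVneq i j) => [<-|ij].
    have -> : cube i a b \o setv i c = cube i (if c then b else a) (if c then b else a).
      by apply: functional_extensionality => f; rewrite /cube /= setv_at if_same.
    exact/M_cube/con_refl.
  have -> : cube i a b \o setv j c = cube i a b; last exact: M_cube.
  by apply: functional_extensionality => f; rewrite /cube /= setv_off.
- case: (eqVneq i j) => [<-|ij].
    have -> : cube i a b \o flip i = cube i b a; last exact/M_cube/con_sym.
    by apply: functional_extensionality => f; rewrite /cube /= ffunE eqxx; case: (f i).
  have -> : cube i a b \o flip j = cube i a b; last exact: M_cube.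
  by apply: functional_extensionality => f; rewrite /cube /= ffunE (negbTE ij).
Qed.

Lemma centralizesP A (t0 t1 t2 : congruence A) j d :
  centralizes t0 t1 t2 j d <-> central (M t0 t1 t2) j d.
Proof.
have edgeP f g : edge j f g <-> f = setv j false g /\ g = setv j true f.
  split=> [[fj gj fg]|[-> ->]]; last first.
    by rewrite !setv_setv; split=> [||i ij]; rewrite ?setv_at ?setv_off.
  by split; apply/ffunP => i; rewrite ffunE; case: eqP => [->|/eqP /fg].
split=> h m Mm supp.
  move=> f pf; apply: (h m Mm) => [g g' /edgeP [gg' g'g] ng||]; last 1 first.
  - by apply/pivotalP; rewrite pivotal_setv.
  - rewrite g'g -{1}(setv_id (j := j) (b := false) (f := g)); last first.
      by rewrite gg' setv_at.
    by apply: supp; apply/pivotalP.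
  by apply/edgeP; rewrite !setv_setv.
move=> f g /edgeP [fg gf] /pivotalP pf.
rewrite gf -{1}(setv_id (j := j) (b := false) (f := f)); last by rewrite fg setv_at.
apply: h => // k /pivotalP pk; apply: supp; first by apply/edgeP; rewrite !setv_setv.
by move/pivotalP; rewrite pivotal_setv => /pivotalP.
Qed.

(** Forming a cube of [star j R] when glued is a congruence on [U], transitive because [star] is
    closed under gluing, and it contains the generating pairs of constants. That [pi] forgets
    coordinate [j] makes each [u \o pi] constant along [j]. *)
Lemma Cg_const_glue (I : Type) A (U : subalgebra (power I A)) (t : congruence A)
    n (j : 'I_n) (R : subalgebra (power (vertex n) A)) (pi : vertex n -> I) :
  (forall b f, pi (setv j b f) = pi f) -> cubical R ->
  (forall u, U u -> R (u \o pi)) ->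
  (forall x y, t x y -> R (glue j (fun=> x) (fun=> y))) ->
  forall u v, Cg_const U t u v ->
    star j R (glue j (sval u \o pi) (sval v \o pi)).
Proof.
move=> pij cR UR tR u v.
pose E (u v : subalg U) := star j R (glue j (sval u \o pi) (sval v \o pi)).
have pis (w : I -> A) : w \o pi = (w \o pi) \o setv j false.
  by apply: functional_extensionality => f /=; rewrite pij.
have Eq : Equivalence E.
  split=> [w|w w'|w w' w'']; rewrite /E.
  - have -> : glue j (sval w \o pi) (sval w \o pi) = sval w \o pi.
      by apply: functional_extensionality => f; rewrite /glue if_same.
    by apply: sub_star => //; apply: UR (proj2_sig w).
  - have [_ sR] := star_cubical j cR.
    move/(sR j); congr (star j R _).
    apply: functional_extensionality => f; rewrite /glue /= ffunE eqxx.
    have -> : pi (flip j f) = pi f by rewrite -(pij true) setv_flip pij.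
    by case: (f j).
  - rewrite (pis (sval w)) (pis (sval w')) (pis (sval w'')); exact: star_trans.
have Eop (s : symbol sg) (a b : 'I_(arity s) -> subalg U) :
    (forall i, E (a i) (b i)) -> E (op a) (op b).
  by move=> /sub_op; rewrite -glue_op.
move=> /(_ (Congruence Eq Eop)); apply=> w w' [x [y [xy wx w'y]]].
by apply: sub_star => //; move: (tR x y xy); rewrite wx w'y.
Qed.

Definition Delta_cubes A (t0 t1 t2 : congruence A) :=
  star dir2 (star dir1 (M t0 t1 t2)).

(** Pairs in [t0] pulled back along coordinate 0 and pairs of constants from [t1] both yield
    generators of [M]. *)
Lemma Delta2_star A (t0 t1 t2 : congruence A) h :
  Delta2 t0 t1 h -> star dir1 (M t0 t1 t2) (h \o base).
Proof.
case=> R0 [R1 h01].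
have := Cg_const_glue (j := dir1) (R := M t0 t1 t2) (pi := fun f => f dir0)
  _ (M_cubical _ _ _) _ _ h01.
have -> : glue dir1 (row h false \o (fun f : vertex 3 => f dir0))
  (row h true \o (fun f : vertex 3 => f dir0)) = h \o base.
  apply: functional_extensionality => f; rewrite /glue /row /base /=.
  by case: (f dir1).
apply=> [b f|u uu|x y xy]; first by rewrite setv_off.
  have -> : u \o (fun f : vertex 3 => f dir0) = cube dir0 (u false) (u true).
    by apply: functional_extensionality => f; rewrite /cube /=; case: (f dir0).
  exact: M_cube.
exact: (M_cube (i := dir1)).
Qed.

Lemma Delta3_star A (t0 t1 t2 : congruence A) h h' :
  Delta3 t0 t1 t2 h h' ->
  Delta_cubes t0 t1 t2 (glue dir2 (h \o base) (h' \o base)).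
Proof.
case=> R0 [R1 h01].
apply: (Cg_const_glue (j := dir2) (R := star dir1 (M t0 t1 t2)) (pi := base)
  _ _ _ _ h01) => [b f|||x y xy].
- by apply/ffunP => i; rewrite !ffunE; case: ifP.
- exact/star_cubical/M_cubical.
- exact: Delta2_star.
- exact/sub_star/(M_cube (i := dir2))/xy/M_cubical.
Qed.

Lemma Delta_cubes_cubical A (t0 t1 t2 : congruence A) :
  cubical (Delta_cubes t0 t1 t2).
Proof. exact/star_cubical/star_cubical/M_cubical. Qed.

Lemma glue_square A (a b c d a' b' c' d' : A) f :
  glue dir2 ([sq c, d; a, b] \o base) ([sq c', d'; a', b'] \o base) f =
  if f dir2 then
    if f dir1 then (if f dir0 then d' else c') else (if f dir0 then b' else a')
  else if f dir1 then (if f dir0 then d else c) else (if f dir0 then b else a).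
Proof. by rewrite /glue /square /= !ffunE. Qed.

Section Modular.
Variable V : algebra sg -> Prop.
Hypotheses (V_variety : variety V) (V_modular : congruence_modular V).
Variables (A : algebra sg) (V_A : V A) (t0 t1 t2 : congruence A).

(** [M] lies in [star j M], which is central in every direction. *)
Lemma centralizes_dir j k d :
  centralizes t0 t1 t2 j d -> centralizes t0 t1 t2 k d.
Proof.
have cM := M_cubical t0 t1 t2.
move=> /centralizesP /(star_central V_variety V_modular (k := k) V_A cM) h.
by apply/centralizesP => m /(sub_star j cM) /h.
Qed.

Lemma Delta_cubes_central j k d :
  centralizes t0 t1 t2 j d -> central (Delta_cubes t0 t1 t2) k d.
Proof.
(* Direction 1 serves the inner closure, which is then central in direction 2, as the outer closure
   requires. *)
move=> /(centralizes_dir (k := dir1)) /centralizesP Md; have cM := M_cubical t0 t1 t2.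
apply: (star_central V_variety V_modular) => //; first exact: star_cubical.
exact: (star_central V_variety V_modular).
Qed.

(** All vertical lines of this cube other than the pivot line are degenerate. *)
Lemma Delta3_pivot_vertical j d a0 a1 a2 x y : centralizes t0 t1 t2 j d ->
  Delta3 t0 t1 t2 [sq a0, a1; a0, a1] [sq a2, y; a2, x] -> d x y.
Proof.
move=> /(Delta_cubes_central (k := dir1)) Dd /Delta3_star /Dd.
have f1 : pivotal dir1 [ffun=> true] by rewrite pivotalE !ffunE.
move=> /(_ _ _ f1); rewrite !glue_square !ffunE /=; apply=> f.
rewrite pivotalE !glue_square !setv_at !setv_off //.
by case: (f dir0); case: (f dir2) => // _; apply: con_refl.
Qed.

Lemma Delta3_pivot_horizontal j d b0 b1 b2 x y : centralizes t0 t1 t2 j d ->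
  Delta3 t0 t1 t2 [sq b1, b1; b0, b0] [sq b2, b2; y, x] -> d x y.
Proof.
move=> /(Delta_cubes_central (k := dir0)) Dd /Delta3_star.
(* The line from [y] to [x] lies at the bottom; a reflection in direction 1 brings it to the pivot
   position. *)
move=> /((Delta_cubes_cubical t0 t1 t2).2 dir1) /Dd.
have f1 : pivotal dir0 [ffun=> true] by rewrite pivotalE !ffunE.
move=> /(_ _ _ f1); rewrite /= !glue_square !ffunE /= => h; apply/con_sym/h => f.
rewrite pivotalE !glue_square !ffunE /=.
by case: (f dir1); case: (f dir2) => // _; apply: con_refl.
Qed.

Lemma Delta3_pivot_depth j d c0 c1 c2 x y : centralizes t0 t1 t2 j d ->
  Delta3 t0 t1 t2 [sq c1, y; c0, c2] [sq c1, x; c0, c2] -> d x y.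
Proof.
move=> /(Delta_cubes_central (k := dir2)) Dd /Delta3_star /Dd.
have f1 : pivotal dir2 [ffun=> true] by rewrite pivotalE !ffunE.
move=> /(_ _ _ f1); rewrite !glue_square !ffunE /= => h; apply/con_sym/h => f.
rewrite pivotalE !glue_square !setv_at !setv_off //.
by case: (f dir0); case: (f dir1) => // _; apply: con_refl.
Qed.
End Modular.
End DeltaCubes.

(** * The congruence defined by corner squares *)

Lemma upd_at (I : eqType) T (h : I -> T) i v : upd h i v i = v.
Proof. by rewrite /upd eqxx. Qed.

Lemma upd_off (I : eqType) T (h : I -> T) i k v : k != i -> upd h i v k = h k.
Proof. by rewrite /upd => /negbTE ->. Qed.

Definition ext (b : bool) (g : vertex 2) : vertex 3 :=
  [ffun i => if i == dir0 then g ord0 else if i == dir1 then g ord_max else b].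

Definition top : vertex 2 := [ffun=> true].

(** Flips exactly the coordinates where [g] is 0, and so carries [top] to [g]. *)
Definition reflect_to (g f : vertex 2) : vertex 2 := [ffun i => f i == g i].

Lemma reflect_to_inv g : involutive (reflect_to g).
Proof. by move=> f; apply/ffunP => i; rewrite !ffunE; case: (f i); case: (g i). Qed.

Lemma reflect_to_top g : reflect_to g top = g.
Proof. by apply/ffunP => i; rewrite !ffunE; case: (g i). Qed.

Definition corner (i j : bool) : vertex 2 :=
  [ffun k : 'I_2 => if k == ord0 then i else j].

Lemma cornerE (f : vertex 2) : f = corner (f ord0) (f ord_max).
Proof.
apply/ffunP => -[[|[|//]] i2]; rewrite ffunE /=; congr (f _); exact: val_inj.
Qed.

Lemma corner_eq i j i' j' : (corner i j == corner i' j') = (i == i') && (j == j').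
Proof.
apply/eqP/andP => [/ffunP e|[/eqP -> /eqP ->] //].
by split; [have := e ord0|have := e ord_max]; rewrite !ffunE /= => ->.
Qed.

Lemma topE : top = corner true true.
Proof. by rewrite [LHS]cornerE !ffunE. Qed.

Lemma row_upd T (h : vertex 2 -> T) g v j :
  row (upd h g v) j =
  if j == g ord_max then upd (row h j) (g ord0) v else row h j.
Proof.
apply: functional_extensionality => i; rewrite /row /upd [g]cornerE corner_eq.
by rewrite !ffunE /= andbC; case: eqP.
Qed.

Lemma row_reflect T (h : vertex 2 -> T) g j :
  row (h \o reflect_to g) j = row h (j == g ord_max) \o (fun i => i == g ord0).
Proof.
apply: functional_extensionality => i; rewrite /row /=; congr (h _).
by rewrite [LHS]cornerE !ffunE.
Qed.

Lemma square_const T (x : T) : [sq x, x; x, x] = fun=> x.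
Proof. by apply: functional_extensionality => f; rewrite /square !if_same. Qed.

Lemma square_upd T (c d a b v : T) : upd [sq c, d; a, b] top v = [sq c, v; a, b].
Proof.
apply: functional_extensionality => f; rewrite /upd [f]cornerE topE corner_eq.
by rewrite /square !ffunE /=; case: (f ord0); case: (f ord_max).
Qed.

Section Delta.
Context {sg : signature}.
Implicit Types A : algebra sg.

(** Reindexing fixes constant functions, hence maps generating pairs to generating pairs. *)
Lemma Cg_const_precomp (I : Type) A (U : subalgebra (power I A))
    (t : congruence A) (s : I -> I) (h h' : I -> A) :
  (forall u, U u -> U (u \o s)) ->
  ambient (Cg_const U t) h h' -> ambient (Cg_const U t) (h \o s) (h' \o s).
Proof.
move=> Us [Uh [Uh' hh']]; exists (Us _ Uh), (Us _ Uh').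
have sh : is_hom (fun u : subalg U =>
    exist _ (sval u \o s) (Us _ (proj2_sig u)) : subalg U).
  by move=> o a; apply: sub_congr.
apply: (Cg_hom sh _ hh') => u v [x [y [xy ux vy]]].
by exists x, y; split=> //=; rewrite ?ux ?vy.
Qed.

Lemma Delta2E A (t0 t1 : congruence A) h :
  Delta2 t0 t1 h =
  ambient (Delta2_con t0 t1) (row h false) (row h true).
Proof. by []. Qed.

Section Modular.
Variable V : algebra sg -> Prop.
Hypotheses (V_variety : variety V) (V_modular : congruence_modular V).
Variables (A : algebra sg) (V_A : V A).

Lemma ambient_shift (I : eqType) (U : subalgebra (power I A))
    (D : congruence (subalg U)) i (h h' g g' : I -> A) :
  (forall k, k != i -> h k = h' k) -> (forall k, k != i -> g k = g' k) ->
  h i = g i -> h' i = g' i -> U g -> U g' -> ambient D h h' -> ambient D g g'.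
Proof.
move=> hh' gg' hg hg' Ug Ug' [Uh [Uh' Dhh']]; exists Ug, Ug'.
exact: (shift V_variety V_modular (i := i) V_A _ _ _ _ Dhh').
Qed.

(** Reindexing by [s] moves the altered entry from [i] to [s i]. As [h] has the value [x] there, the
    shifting lemma exchanges the remaining constant entries for those of [h]. *)
Lemma Cg_const_upd (I : eqType) (U : subalgebra (power I A)) (t : congruence A)
    (s : I -> I) i (h : I -> A) x y :
  (forall u, U u -> U (u \o s)) -> involutive s ->
  ambient (Cg_const U t) (fun=> x) (upd (fun=> x) i y) ->
  h (s i) = x -> U h -> U (upd h (s i) y) ->
  ambient (Cg_const U t) h (upd h (s i) y).
Proof.
move=> Us si /(Cg_const_precomp Us) Dxy hx Uh Uh'.
apply: (ambient_shift (i := s i) _ _ _ _ Uh Uh' Dxy) => //=.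
- by move=> k ki; rewrite upd_off // -(inj_eq (inv_inj si)) si.
- by move=> k ki; rewrite upd_off.
- by rewrite si !upd_at.
Qed.

Variables t0 t1 t2 : congruence A.
Let D2 := ambient (Delta2_con t0 t1).

Lemma con_subalgebra_negb (b : bool) (p : bool -> A) :
  con_subalgebra t0 p -> con_subalgebra t0 (p \o (fun c => c == b)).
Proof. by case: b => //= h; apply: con_sym. Qed.

Lemma Delta2_con_upd (p : bool -> A) b y : con_subalgebra t0 p ->
  D2 (fun=> p b) (upd (fun=> p b) true y) -> D2 p (upd p b y).
Proof.
move=> tp Dy; have [_ [ty _]] := Dy.
have inv : involutive (fun c => c == b) by case: b {Dy ty} => -[].
have := @Cg_const_upd _ _ t1 _ true p _ y (@con_subalgebra_negb b) inv Dy.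
rewrite (_ : (true == b) = b); last by case: b {Dy ty inv}.
apply=> //; move: ty tp; rewrite /con_subalgebra /upd /=.
by case: b {Dy inv} => /= h h'; [apply: con_trans h' h|apply: con_trans (con_sym h) h'].
Qed.

Lemma Delta2_reflect g h : Delta2 t0 t1 h -> Delta2 t0 t1 (h \o reflect_to g).
Proof.
rewrite !Delta2E !row_reflect => Dh.
apply: (Cg_const_precomp (@con_subalgebra_negb _)).
by case: (g ord_max) => //; apply: ambient_sym.
Qed.

Lemma Delta2_const x : Delta2 t0 t1 (fun=> x).
Proof. by apply: ambient_refl; apply: con_refl. Qed.

Definition delta_rel (x y : A) : Prop :=
  Delta3 t0 t1 t2 (fun=> x) (upd (fun=> x) top y).

Lemma delta_relE x y :
  delta_rel x y = Delta3 t0 t1 t2 [sq x, x; x, x] [sq x, y; x, x].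
Proof. by rewrite -(square_upd x x x x y) square_const. Qed.

Lemma delta_rel_row x y : delta_rel x y -> D2 (fun=> x) (upd (fun=> x) true y).
Proof.
case=> _ [+ _]; rewrite !Delta2E !row_upd !ffunE => h; exact: h.
Qed.

(** The altered square stays in [Delta2] since [Delta2_con_upd] handles its row through [g]; then
    [Cg_const_upd] applies with the reflection carrying [top] to [g]. *)
Lemma delta_rel_upd h g y : Delta2 t0 t1 h -> delta_rel (h g) y ->
  Delta3 t0 t1 t2 h (upd h g y).
Proof.
move=> Dh dy.
have hg : row h (g ord_max) (g ord0) = h g by rewrite {3}[g]cornerE.
have th j : con_subalgebra t0 (row h j).
  by case: j; case: Dh => R0 [R1 _].
have Dr : D2 (row h (g ord_max)) (upd (row h (g ord_max)) (g ord0) y).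
  by apply: Delta2_con_upd; rewrite ?hg //; apply: delta_rel_row.
have Dh' : Delta2 t0 t1 (upd h g y).
  rewrite !Delta2E !row_upd; case: (g ord_max) Dr => Dr.
    exact: ambient_trans Dh Dr.
  exact: ambient_trans (ambient_sym Dr) Dh.
have := Cg_const_upd (h := h) (@Delta2_reflect g) (@reflect_to_inv g) dy.
by rewrite reflect_to_top; apply.
Qed.

(** The shifting lemma exchanges the common entries for [h top]. That the new square is in [Delta2]
    takes another shift, between the upper rows, which are related because the lower rows
    coincide. *)
Lemma Delta3_corner h h' : (forall g, g != top -> h g = h' g) ->
  Delta3 t0 t1 t2 h h' -> delta_rel (h top) (h' top).
Proof.
move=> hh' Dhh'; have [Dh [Dh' _]] := Dhh'.
have row0 : row h false = row h' false.
  by apply: functional_extensionality => i; apply: hh'; rewrite topE corner_eq andbF.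
have D1 : D2 (row h true) (row h' true).
  by apply: ambient_trans (ambient_sym Dh) _; rewrite row0.
have [th [th' _]] := D1.
have e : h (corner false true) = h' (corner false true).
  by apply: hh'; rewrite topE corner_eq.
have txy : t0 (h top) (h' top).
  by rewrite topE; apply: con_trans (con_sym th) _; rewrite [row _ _ _]e.
have Dxy : Delta2 t0 t1 (upd (fun=> h top) top (h' top)).
  rewrite !Delta2E !row_upd !ffunE.
  apply: (ambient_shift (i := true) _ _ _ _ _ _ D1) => //.
  - by case=> // _; apply: e.
  - by case.
  - by rewrite topE.
  - by rewrite topE.
  - exact: con_refl.
apply: (ambient_shift hh' _ _ _ (Delta2_const _) Dxy Dhh') => //.
  by move=> k kt; rewrite upd_off.
by rewrite upd_at.
Qed.

Lemma delta_rel_equiv : Equivalence delta_rel.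
Proof.
have sy x y : delta_rel x y -> delta_rel y x.
  move=> /ambient_sym /Delta3_corner; rewrite upd_at; apply=> g gt.
  by rewrite upd_off.
split=> // [x|x y z dxy dyz].
  rewrite delta_relE square_const; exact/ambient_refl/Delta2_const.
have [_ [Dy _]] := dxy.
(* Transitivity: the entry [y] of the second square is replaced by [z], and [Delta3_corner] is
   applied to the composite. *)
have := delta_rel_upd (g := top) (y := z) Dy; rewrite upd_at => /(_ dyz).
move/(ambient_trans dxy)/Delta3_corner; rewrite upd_at; apply=> g gt.
by rewrite !upd_off.
Qed.

Lemma delta_rel_op (s : symbol sg) (a b : 'I_(arity s) -> A) :
  (forall i, delta_rel (a i) (b i)) -> delta_rel (op a) (op b).
Proof.
move=> /ambient_op; rewrite /delta_rel /=; congr (Delta3 t0 t1 t2 _ _).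
by apply: functional_extensionality => g; rewrite /upd; case: eqP.
Qed.

Definition delta_con : congruence A := Congruence delta_rel_equiv delta_rel_op.

(** Generators in directions 0 and 1 give two equal faces in [Delta2]; those in direction 2 give a
    generating pair of constants. *)
Lemma M_Delta3 m : M t0 t1 t2 m -> Delta3 t0 t1 t2 (m \o ext false) (m \o ext true).
Proof.
have Rop (s : symbol sg) (a : 'I_(arity s) -> power (vertex 3) A) :
    (forall i, Delta3 t0 t1 t2 (a i \o ext false) (a i \o ext true)) ->
    Delta3 t0 t1 t2 (op a \o ext false) (op a \o ext true).
  exact: (@ambient_op sg (power (vertex 2) A)).
move=> /(_ (@Subalgebra sg (power (vertex 3) A)
  (fun m => Delta3 t0 t1 t2 (m \o ext false) (m \o ext true)) Rop)).
apply=> _ [i [a [b [ab ->]]]] /=.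
have cubeE c : cube i a b \o ext c =
    if i == dir0 then fun g => if g ord0 then b else a
    else if i == dir1 then fun g => if g ord_max then b else a
    else fun=> if c then b else a.
  apply: functional_extensionality => g; rewrite /cube /= ffunE.
  by case: eqP => //; case: eqP.
rewrite !cubeE; case: i ab {cubeE} => [[|[|[|//]]] i3] /= ab.
- have rowE j : row (fun g : vertex 2 => if g ord0 then b else a) j =
      fun i => if i then b else a.
    by apply: functional_extensionality => i; rewrite /row ffunE.
  by apply: ambient_refl; rewrite !Delta2E !rowE; apply: ambient_refl.
- have rowE j : row (fun g : vertex 2 => if g ord_max then b else a) j =
      fun=> if j then b else a.
    by apply: functional_extensionality => i; rewrite /row ffunE.
  apply: ambient_refl; rewrite !Delta2E !rowE.
  by exists (con_refl t0 a), (con_refl t0 b); apply: Cg_gen; exists a, b.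
- by exists (Delta2_const a), (Delta2_const b); apply: Cg_gen; exists a, b.
Qed.

Lemma delta_con_centralizes : centralizes t0 t1 t2 dir2 delta_con.
Proof.
apply/centralizesP => m Mm supp f pf.
have extE b c g : setv dir2 b (ext c g) = ext b g.
  by apply/ffunP => i; case: (dirP i) => ->; rewrite !ffunE.
have supp' g : g != top -> delta_con (m (ext false g)) (m (ext true g)).
  move=> gt; rewrite -(extE false false) -(extE true false); apply: supp.
  rewrite pivotalE !ffunE /=; apply: contra gt => /andP[g0 g1].
  by rewrite topE [g]cornerE corner_eq g0 g1.
have fE b : setv dir2 b f = ext b top.
  move: pf; rewrite pivotalE => /andP[f0 f1].
  by apply/ffunP => i; case: (dirP i) => ->; rewrite !ffunE /= ?f0 ?f1.
rewrite !fE.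
have Dm := M_Delta3 Mm.
(* [h] is the face at height 1 in direction 2 with all entries but that at [top] exchanged, one
   vertex at a time, for those of the face at height 0. Each exchange is a [Delta3]-step by
   [delta_rel_upd]. *)
have [h [Dh hs hN]] : exists h : vertex 2 -> A,
    [/\ Delta3 t0 t1 t2 (m \o ext true) h,
        forall g, g \in enum (predC1 top) -> h g = m (ext false g) &
        forall g, g \notin enum (predC1 top) -> h g = m (ext true g)].
  have : {subset enum (predC1 top) <= predC1 top} by move=> g; rewrite mem_enum.
  elim: (enum _) => [|g s IH] sub.
    by exists (m \o ext true); split=> //; apply: ambient_refl; case: Dm => ? [].
  have [g' g's|h [Dh hs hN]] := IH; first by apply: sub; rewrite inE g's orbT.
  have [_ [D2h _]] := Dh.
  have dg : delta_rel (h g) (m (ext false g)).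
    case: (boolP (g \in s)) => [/hs ->|/hN ->]; first exact: (con_refl delta_con).
    by apply/(con_sym (d := delta_con))/supp'/sub/mem_head.
  exists (upd h g (m (ext false g))); split=> [|g'|g'].
  - exact: ambient_trans Dh (delta_rel_upd D2h dg).
  - by rewrite inE /upd; case: eqP => [-> //|_ /hs].
  - by rewrite inE negb_or => /andP[ne /hN]; rewrite upd_off.
have := Delta3_corner _ (ambient_trans Dm Dh).
rewrite (hN top) ?mem_enum ?inE ?eqxx //; apply=> g gt.
by rewrite hs // mem_enum inE.
Qed.

Lemma commutator_delta j x y :
  commutator j t0 t1 t2 x y -> Delta3 t0 t1 t2 [sq x, x; x, x] [sq x, y; x, x].
Proof.
rewrite -delta_relE => /(_ delta_con); apply.
exact: (centralizes_dir V_variety V_modular V_A delta_con_centralizes).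
Qed.
End Modular.
End Delta.

(** * Equivalence of the five conditions *)

Theorem theorem7p6 (sg : signature) (V : algebra sg -> Prop)
    (V_variety : variety V) (V_modular : congruence_modular V)
    (A : algebra sg) (V_A : V A) (t0 t1 t2 : congruence A) (x y : A)
    (j : 'I_3) :
  [<-> commutator j t0 t1 t2 x y;
       Delta3 t0 t1 t2 [sq x, x; x, x] [sq x, y; x, x];
       exists a0 a1 a2 : A,
         Delta3 t0 t1 t2 [sq a0, a1; a0, a1] [sq a2, y; a2, x];
       exists b0 b1 b2 : A,
         Delta3 t0 t1 t2 [sq b1, b1; b0, b0] [sq b2, b2; y, x];
       exists c0 c1 c2 : A,
         Delta3 t0 t1 t2 [sq c1, y; c0, c2] [sq c1, x; c0, c2] ].
Proof.
have [Cj _] := commutator_least j t0 t1 t2.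
have C12 := @commutator_delta sg V V_variety V_modular A V_A t0 t1 t2 j x y.
tfae => //.
- by move=> h; exists x, x, x.
(* Condition (3) gives (1), hence (2); altering the constant square at its lower left corner instead
   of [top] then gives (4). *)
- case=> a0 [a1 [a2 /(Delta3_pivot_vertical V_variety V_modular V_A Cj) /C12]].
  rewrite -delta_relE => dxy; exists x, x, x.
  have := delta_rel_upd V_variety V_modular V_A (g := corner false false)
    (Delta2_const t0 t1 x) dxy.
  rewrite square_const; congr (Delta3 t0 t1 t2 _ _).
  apply: functional_extensionality => f.
  rewrite /upd [f]cornerE corner_eq /square !ffunE /=.
  by case: (f ord0); case: (f ord_max).
(* With every [c] equal to [x], condition (5) is (2) reversed. *)
- case=> b0 [b1 [b2 /(Delta3_pivot_horizontal V_variety V_modular V_A Cj) /C12]].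
  by move=> /ambient_sym h; exists x, x, x.
- by case=> c0 [c1 [c2 /(Delta3_pivot_depth V_variety V_modular V_A Cj)]].
Qed.
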